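(* Let $\overline{p}(n)$ denote the number of overpartitions of $n$, and for $n\ge1$ set $$\alpha(n)=2\sigma_1(n)-2\bar{\sigma}_1(n),\qquad \bar{\sigma}_1(n)=\begin{cases}\sigma_1(n/2), & 2\mid n,\\ 0, & 2\nmid n.\end{cases}$$ Then for every integer $n\ge1$, $$\overline{p}(n)=\frac{1}{n!}B_n\big(0!\,\alpha(1),\,1!\,\alpha(2),\,\ldots,\,(n-1)!\,\alpha(n)\big),$$ equivalently $$\overline{p}(n)=\sum_{\beta=(1^{m_1},\ldots,n^{m_n})\vdash n}\ \prod_{j=1}^n\frac{1}{m_j!}\Big(\frac{\alpha(j)}{j}\Big)^{m_j},$$ and conversely $$\alpha(n)=n\sum_{\beta=(1^{m_1},\ldots,n^{m_n})\vdash n}(-1)^{\ell(\beta)-1}(\ell(\beta)-1)!\prod_{j=1}^n\frac{\overline{p}(j)^{m_j}}{m_j!}.$$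
   Context: An overpartition of $n$ is a partition of $n$ in which the first occurrence of each part may be overlined; the generating function (a known result) is $\sum_{n\ge0}\overline{p}(n)q^n=\prod_{n\ge1}\frac{1+q^n}{1-q^n}=\prod_{n\ge1}\frac{1-q^{2n}}{(1-q^n)^2}$. Here $\sigma_1(n)=\sum_{d\mid n}d$. The complete Bell polynomials $B_n(Y_1,\ldots,Y_n)$ are defined by $$\sum_{n=0}^\infty B_n(Y_1,\ldots,Y_n)\frac{u^n}{n!}=\exp\Big(\sum_{j=1}^\infty Y_j\frac{u^j}{j!}\Big).$$ A partition $\beta$ of $n$ is written $\beta=(1^{m_1},\ldots,n^{m_n})\vdash n$, where $m_j\ge0$ is the multiplicity of the part $j$ (so $\sum_j j\,m_j=n$), and $\ell(\beta)=m_1+\cdots+m_n$. *)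

(* Defs.v *)
From HB Require Import structures.
From mathcomp Require Import all_boot all_order all_algebra.
From mathcomp Require Import mpoly.

Set Implicit Arguments.
Unset Strict Implicit.
Unset Printing Implicit Defensive.

Import GRing.Theory.
Local Open Scope ring_scope.

(* The multiplicity vector (1^{m_1}, ..., n^{m_n}): [b i] is m_{i+1}.  The bound
   m_j <= n in the type excludes no partition of n. *)
Definition mults (n : nat) : finType := {ffun 'I_n -> 'I_n.+1}.

Definition is_partition (n : nat) (b : mults n) : bool :=
  (\sum_(i < n) i.+1 * b i == n)%N.

Definition plength (n : nat) (b : mults n) : nat := (\sum_(i < n) b i)%N.

(* As only the first occurrence of a part may be overlined, an overpartition is
   a partition together with a set of overlined part sizes (i stands for i+1),
   each of which occurs in the partition. *)
Definition is_overpartition (n : nat) (x : mults n * {set 'I_n}) : bool :=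
  is_partition x.1 && (x.2 \subset [set i | (0 < x.1 i)%N]).

Definition overp (n : nat) : nat :=
  #|[set x : mults n * {set 'I_n} | is_overpartition x]|.

Definition sigma1 (n : nat) : nat := (\sum_(d <- divisors n) d)%N.

Definition sigma1bar (n : nat) : nat :=
  if (2 %| n)%N then sigma1 (n %/ 2) else 0%N.

Definition alpha (n : nat) : rat :=
  2 * (sigma1 n)%:R - 2 * (sigma1bar n)%:R.

(* A formal power series is represented by its coefficient sequence. *)
Section Fps.
Variable A : algType rat.
Implicit Types f g : nat -> A.

Definition fps_one : nat -> A := fun n => (n == 0%N)%:R.

Definition fps_mul f g : nat -> A :=
  fun n => \sum_(i < n.+1) f i * g (n - i)%N.

Definition fps_pow f (k : nat) : nat -> A := iter k (fps_mul f) fps_one.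

(* exp(f) = \sum_k f^k / k! for f without constant term.  The sum defining the
   coefficient of u^n may stop at k = n, see [fps_pow_eq0]. *)
Definition fps_exp f : nat -> A :=
  fun n => \sum_(k < n.+1) (k`!%:R : rat)^-1 *: fps_pow f k n.

Lemma fps_pow_eq0 f k n : f 0%N = 0 -> (n < k)%N -> fps_pow f k n = 0.
Proof.
move=> f0; elim: k n => [//|k IHk] n lt_nk /=.
rewrite /fps_mul big1 // => -[[|i] Hi] _ /=; first by rewrite f0 mul0r.
rewrite IHk ?mulr0 //.
rewrite ltnS in Hi; rewrite subnS prednK ?subn_gt0 //.
by apply: leq_trans (leq_subr _ _) _; rewrite -ltnS.
Qed.

Lemma eq_fps_exp f g n :
  (forall j, (j <= n)%N -> f j = g j) -> fps_exp f n = fps_exp g n.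
Proof.
move=> fg; apply: eq_bigr => -[k _] _ /=; congr (_ *: _).
elim: k n fg => [//|k IHk] n fg /=.
apply: eq_bigr => i _; rewrite fg -1?ltnS //; congr (_ * _).
by apply: IHk => j le_j; apply: fg; apply: leq_trans le_j (leq_subr _ _).
Qed.

End Fps.

(* The series \sum_{j=1}^n Y_j u^j / j!, where Y_j is the variable 'X_(j-1). *)
Definition bell_arg (n : nat) : nat -> {mpoly rat[n]} :=
  fun j => \sum_(i < n | i.+1 == j) (j`!%:R : rat)^-1 *: 'X_i.

(* The Y_j with j > n do not contribute to the coefficient of u^n; [bellE]
   gives the generating function with the whole sequence of the Y_j. *)
Definition bell (n : nat) : {mpoly rat[n]} :=
  (n`!%:R : rat) *: fps_exp (@bell_arg n) n.

Lemma bellE (Y : nat -> rat) (n : nat) :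
  (n`!%:R)^-1 * (bell n).@[fun i : 'I_n => Y i.+1] =
  fps_exp (fun j => if j == 0%N then 0 else Y j / j`!%:R : rat^o) n.
Proof.
rewrite /bell mevalZ mulKf ?Num.Theory.pnatr_eq0 -?lt0n ?fact_gt0 //.
set v := fun i : 'I_n => Y i.+1.
have meval_exp : (fps_exp (@bell_arg n) n).@[v] =
    fps_exp (fun j => (bell_arg n j).@[v] : rat^o) n.
  rewrite /fps_exp raddf_sum; apply: eq_bigr => -[k Hk] _ /=.
  rewrite mevalZ; congr (_ * _).
  have: forall m, (fps_pow (@bell_arg n) k m).@[v] =
      fps_pow (fun j => (bell_arg n j).@[v] : rat^o) k m; last exact.
  elim: k {Hk} => [|k IHk] m /=.
    by rewrite /fps_one raddfMn /= meval1.
  rewrite /fps_mul raddf_sum; apply: eq_bigr => i _ /=.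
  by rewrite mevalM IHk.
rewrite meval_exp; apply: (@eq_fps_exp rat^o) => -[|j] le_jn /=.
  by rewrite /bell_arg big_pred0_eq ?raddf0.
rewrite /bell_arg (big_pred1 (Ordinal le_jn)) => [|i].
  by rewrite mevalZ mevalXU mulrC.
by rewrite eqSS.
Qed.

(* Main.v *)
Require Import Defs.
From HB Require Import structures.
From mathcomp Require Import all_boot all_order all_algebra.
From mathcomp Require Import mpoly.
From mathcomp Require Import ring.

Import GRing.Theory.
Local Open Scope ring_scope.

(* Everything is done with polynomials modulo a power of 'X.  Expanding
   prod_i exp(f_i X^i t) in a second variable t shows that the sum over the
   partitions of n into k parts is the coefficient of X^n in F^k / k!, where
   F = sum_i f_i X^i; hence the first two formulas assert P = exp A, and the
   third A = log P, for P = sum_n overp(n) X^n and A = sum_n alpha(n) X^n / n.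
   Both follow from P' = P A', the logarithmic derivative of
   P = prod_d (1 + X^d) / (1 - X^d), because
   y d/dy log ((1 + y) / (1 - y)) = 2 (y + y^3 + y^5 + ...). *)

(** * Congruences modulo a power of ['X] *)

Lemma dvdXnP (p : {poly rat}) N :
  reflect (forall i, (i < N)%N -> p`_i = 0) ('X^N %| p).
Proof.
apply: (iffP idP) => [/dvdpP[r ->] i lt_iN|p0]; first by rewrite coefMXn lt_iN.
have -> : p = drop_poly N p * 'X^N.
  rewrite -{1}(poly_take_drop N p) [take_poly N p](_ : _ = 0) ?add0r //.
  by apply/polyP => i; rewrite coef_take_poly coef0; case: ifP => // /p0.
exact: dvdp_mull.
Qed.

Lemma coef_dvdXn_sub (p q : {poly rat}) N i :
  'X^N %| p - q -> (i < N)%N -> p`_i = q`_i.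
Proof. by move=> /dvdXnP/[apply]/eqP; rewrite coefB subr_eq0 => /eqP. Qed.

Lemma dvdp_subM (d p q r s : {poly rat}) :
  d %| p - q -> d %| r - s -> d %| p * r - q * s.
Proof.
move=> pq rs; have -> : p * r - q * s = (p - q) * r + q * (r - s) by ring.
by apply: dvdp_add; [apply: dvdp_mulr | apply: dvdp_mull].
Qed.

(** * Sums over partitions as polynomial coefficients *)

(** This is exp(x_0 t) ... exp(x_(N-1) t) = exp((x_0 + ... + x_(N-1)) t), read at t^k: truncating
    each factor below t^M leaves the coefficients with k < M intact. The induction step is the
    binomial theorem. *)
Lemma coef_prod_exp {R : comAlgType rat} (x : nat -> R) N M k : (k < M)%N ->
  (\prod_(i < N) \poly_(m < M) ((m`!%:R : rat)^-1 *: x i ^+ m))`_k =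
  (k`!%:R : rat)^-1 *: (\sum_(i < N) x i) ^+ k.
Proof.
elim: N k => [|N IHN] k lt_kM.
  rewrite !big_ord0 coef1 expr0n; case: k {lt_kM} => [|k] /=.
    by rewrite invr1 scale1r.
  by rewrite scaler0.
rewrite !big_ord_recr /= addrC exprDn coefM scaler_sumr; apply: eq_bigr => j _.
have le_jk : (j <= k)%N by rewrite -ltnS.
rewrite IHN ?(leq_ltn_trans le_jk) // coef_poly.
rewrite (leq_ltn_trans (leq_subr _ _)) // -scalerAl -scalerAr scalerA.
rewrite -[in RHS]scaler_nat scalerA [x N ^+ _ * _]mulrC; congr (_ *: _).
have nz m : (m`!%:R : rat) != 0 by rewrite Num.Theory.pnatr_eq0 -lt0n fact_gt0.
rewrite -(bin_fact le_jk) !natrM; field.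
by rewrite !nz Num.Theory.pnatr_eq0 -lt0n bin_gt0 le_jk.
Qed.

(** Expanding the product chooses a multiplicity for each part size, and the exponent of the
    resulting monomial is the number being partitioned. *)
Lemma partition_prod_coef (c : nat -> nat -> rat) n :
  \sum_(b : mults n | is_partition b) \prod_(i < n) c i (b i) =
  (\prod_(i < n) \sum_(m < n.+1) c i m *: 'X^(i.+1 * m))`_n.
Proof.
rewrite bigA_distr_bigA coef_sum big_mkcond; apply: eq_bigr => b _ /=.
rewrite scaler_prod prodrXr coefZ coefXn eq_sym /is_partition.
by case: eqP => _; rewrite ?mulr1 ?mulr0.
Qed.

(** [coef_prod_exp] is used over the ring [{poly rat}]: the outer variable t records the length, the
    inner ['X] the number partitioned. As k <= n, truncating at t^n is harmless. *)
Lemma partition_length_coef (f : nat -> rat) n k : (k <= n)%N ->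
  \sum_(b : mults n | is_partition b && (plength b == k))
     \prod_(i < n) (((b i)`!%:R)^-1 * f i ^+ b i) =
  (k`!%:R)^-1 * ((\sum_(i < n) f i *: 'X^(i.+1)) ^+ k)`_n.
Proof.
move=> le_kn; rewrite -coefZ.
rewrite -(@coef_prod_exp _ (fun i => f i *: 'X^(i.+1)) n n.+1) //.
rewrite (eq_bigr _ (fun i _ => poly_def _ _)).
rewrite bigA_distr_bigA !coef_sum big_mkcond; apply: eq_bigr => b _ /=.
rewrite scaler_prod prodrXr coefZ coefXn /is_partition eq_sym.
have -> : \prod_(i < n) (((b i)`!%:R : rat)^-1 *: (f i *: 'X^(i.+1)) ^+ b i) =
    (\prod_(i < n) ((b i)`!%:R^-1 * f i ^+ b i)) *:
      'X^(\sum_(i < n) i.+1 * b i)%N :> {poly rat}.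
  rewrite -prodrXr -scaler_prod; apply: eq_bigr => i _.
  by rewrite exprZn -exprM scalerA.
rewrite [k == _]eq_sym -/(plength b) mulr_natr coefMn coefZ coefXn.
by case: eqP; case: eqP => _ _ /=; rewrite ?mulr1 ?mulr0 ?mulr1n ?mulr0n.
Qed.

Lemma plength_le n (b : mults n) : is_partition b -> (plength b <= n)%N.
Proof.
by move=> /eqP def_n; rewrite -{2}def_n; apply: leq_sum => i _; rewrite leq_pmull.
Qed.

Lemma plength_gt0 n (b : mults n) :
  (0 < n)%N -> is_partition b -> (0 < plength b)%N.
Proof.
move=> n_gt0 /eqP def_n; rewrite lt0n; apply/eqP => /eqP.
rewrite sum_nat_eq0 => /forallP b0.
by move: n_gt0; rewrite -def_n big1 // => i _; rewrite (eqP (b0 i)) muln0.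
Qed.

Lemma partition_sum_by_length n (c : nat -> rat) (F : mults n -> rat) :
  \sum_(b : mults n | is_partition b) c (plength b) * F b =
  \sum_(k < n.+1) c k * \sum_(b | is_partition b && (plength b == k)) F b.
Proof.
rewrite (partition_big (fun b => inord (plength b) : 'I_n.+1) xpredT) //=.
apply: eq_bigr => k _; rewrite big_distrr /=; apply: eq_big => b.
  apply/andb_id2l => pb; rewrite -val_eqE /= inordK // ltnS.
  exact: plength_le.
by move=> /andP[pb /eqP <-]; rewrite inordK // ltnS plength_le.
Qed.

(** * Truncated exponential and logarithm *)

(** The shift matches [mults], where index i stands for the part i+1; it also forces a zero constant
    term, so that truncated exp and log series are exact in low degree. *)
Definition gfpoly (f : nat -> rat) n : {poly rat} :=
  \sum_(i < n) f i *: 'X^(i.+1).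

Lemma coef_gfpoly f n j :
  (gfpoly f n)`_j = if (0 < j <= n)%N then f j.-1 else 0.
Proof.
have -> : gfpoly f n = (\poly_(i < n) f i) * 'X.
  rewrite poly_def mulr_suml; apply: eq_bigr => i _.
  by rewrite -scalerAl -exprSr.
by rewrite coefMX coef_poly; case: j.
Qed.

Lemma dvdXn_gfpoly_exp f n k : 'X^k %| gfpoly f n ^+ k.
Proof.
apply: dvdp_exp2r; rewrite -[X in X %| _]expr1; apply/dvdXnP => -[|//] _.
by rewrite coef_gfpoly.
Qed.

Definition exp_poly (F : {poly rat}) n : {poly rat} :=
  \sum_(k < n.+1) (k`!%:R)^-1 *: F ^+ k.

Lemma partition_exp_coef (f : nat -> rat) n :
  \sum_(b : mults n | is_partition b)
     \prod_(i < n) (((b i)`!%:R)^-1 * f i ^+ b i) =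
  (exp_poly (gfpoly f n) n)`_n.
Proof.
under eq_bigr => b _ do rewrite -[\prod_(i < n) _]mul1r.
rewrite (partition_sum_by_length n (fun=> 1)) coef_sum; apply: eq_bigr => k _.
by rewrite mul1r partition_length_coef ?coefZ // -ltnS.
Qed.

Lemma fps_pow_polyE (f : nat -> rat^o) (F : {poly rat}) n :
  (forall j, (j <= n)%N -> F`_j = f j) ->
  forall k m, (m <= n)%N -> fps_pow f k m = (F ^+ k)`_m.
Proof.
move=> Ff; elim=> [|k IHk] m le_mn /=; first by rewrite expr0 coef1.
rewrite exprS coefM; apply: eq_bigr => i _; rewrite Ff ?IHk //.
  exact: leq_trans (leq_subr _ _) le_mn.
by apply: leq_trans le_mn; rewrite -ltnS.
Qed.

Lemma fps_exp_polyE (f : nat -> rat^o) (F : {poly rat}) n :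
  (forall j, (j <= n)%N -> F`_j = f j) -> fps_exp f n = (exp_poly F n)`_n.
Proof.
move=> Ff; rewrite coef_sum; apply: eq_bigr => k _.
by rewrite coefZ (fps_pow_polyE f F n Ff).
Qed.

(** Differentiating shifts the exponential sum by one, so all terms cancel except the top one, - F^n
    F' / n!, and ['X] divides F. *)
Lemma deriv_exp_poly f n :
  'X^n %| (exp_poly (gfpoly f n) n)^`()
            - exp_poly (gfpoly f n) n * (gfpoly f n)^`().
Proof.
set F := gfpoly f n; have -> : (exp_poly F n)^`() - exp_poly F n * F^`() =
   F ^+ n * (- (n`!%:R)^-1 *: F^`()).
  rewrite {1}/exp_poly big_ord_recl derivD derivZ derivC scaler0 add0r.
  rewrite raddf_sum /exp_poly big_ord_recr /= mulrDl opprD addrA mulr_suml.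
  rewrite -sumrB big1 ?add0r => [|k _].
    by rewrite scaleNr mulrN -scalerAl -scalerAr.
  rewrite derivZ deriv_exp /bump /= add1n factS.
  rewrite -mulrnAl -scaler_nat -scalerAl scalerA -scalerAl [F^`() * _]mulrC.
  have nz m : (m`!%:R : rat) != 0.
    by rewrite Num.Theory.pnatr_eq0 -lt0n fact_gt0.
  apply/eqP; rewrite subr_eq0; apply/eqP; congr (_ *: _).
  by rewrite natrM; field; rewrite nz nat1r Num.Theory.pnatr_eq0.
by apply/dvdp_mulr/dvdXn_gfpoly_exp.
Qed.

(** Comparing coefficients in P' = P B gives (n+1) P_(n+1) in terms of P_0, ..., P_n, and n+1 is
    invertible in [rat]. *)
Lemma ode_unique (P Q B : {poly rat}) N : P`_0 = Q`_0 ->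
  'X^N %| P^`() - P * B -> 'X^N %| Q^`() - Q * B ->
  forall n, (n <= N)%N -> P`_n = Q`_n.
Proof.
move=> PQ0 dP dQ; elim/ltn_ind => -[//|n] IHn lt_nN.
have := coef_dvdXn_sub _ _ _ _ dP lt_nN; rewrite coef_deriv coefM => eP.
have := coef_dvdXn_sub _ _ _ _ dQ lt_nN; rewrite coef_deriv coefM => eQ.
have: P`_n.+1 *+ n.+1 = Q`_n.+1 *+ n.+1.
  rewrite eP eQ; apply: eq_bigr => i _; congr (_ * _); apply: IHn => //.
  by apply: leq_trans (ltnW lt_nN); rewrite -ltnS.
exact: Num.Theory.pmulrnI.
Qed.

(** Truncation of log(1 + G). *)
Definition log_poly (G : {poly rat}) n : {poly rat} :=
  \sum_(k < n) ((-1) ^+ k / k.+1%:R) *: G ^+ k.+1.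

(** The derivative of the logarithm is G' times a geometric sum of ratio -G, so the error is -
    (-G)^n G'. *)
Lemma deriv_log_poly f n :
  'X^n %| (1 + gfpoly f n) * (log_poly (gfpoly f n) n)^`() - (gfpoly f n)^`().
Proof.
set G := gfpoly f n.
have -> : (log_poly G n)^`() = (\sum_(k < n) (- G) ^+ k) * G^`().
  rewrite raddf_sum mulr_suml; apply: eq_bigr => k _.
  rewrite [LHS]derivZ deriv_exp -(@scaler_nat _ {poly rat}) scalerA.
  rewrite divfK ?Num.Theory.pnatr_eq0 // [G^`() * _]mulrC.
  by rewrite -signr_odd scaler_sign exprNn -[in RHS]signr_odd mulr_sign;
     case: (odd k); rewrite ?mulNr.
have -> : (1 + G) * ((\sum_(k < n) (- G) ^+ k) * G^`()) - G^`() =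
    - (- G) ^+ n * G^`().
  have -> : (- G) ^+ n = 1 + (- G - 1) * \sum_(k < n) (- G) ^+ k.
    by rewrite -subrX1 addrC subrK.
  ring.
rewrite exprNn mulNr dvdpNr -mulrA.
by apply/dvdp_mull/dvdp_mulr/dvdXn_gfpoly_exp.
Qed.

(** * The overpartition generating function and its factors *)

(* (1 + y) / (1 - y) = sum_m wt(m) y^m *)
Definition wt (m : nat) : rat := if m == 0 then 1 else 2.

Definition wt_poly M : {poly rat} := \poly_(m < M.+1) wt m.

Definition overp_poly N : {poly rat} :=
  \prod_(i < N) (wt_poly N \Po 'X^(i.+1)).

(** The overlined sets allowed for [b] are the subsets of its support: each part size that occurs
    contributes a factor 2. *)
Lemma overp_partition_sum n :
  (overp n)%:R = \sum_(b : mults n | is_partition b) \prod_(i < n) wt (b i).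
Proof.
rewrite /overp -sum1dep_card -(pair_big_dep (@is_partition n)
  (fun b (A : {set 'I_n}) => A \subset [set i | (0 < b i)%N]) (fun _ _ => 1%N)) /=.
rewrite natr_sum; apply: eq_bigr => b _.
rewrite sum1dep_card -/(powerset _) card_powerset natrX -prodr_const.
rewrite big_mkcond; apply: eq_bigr => i _.
by rewrite inE /wt; case: (b i : nat).
Qed.

Lemma dvdp_sub_prod (I : finType) (d : {poly rat}) (F G : I -> {poly rat}) :
  (forall i, d %| F i - G i) -> d %| \prod_i F i - \prod_i G i.
Proof.
move=> FG; elim/big_ind2: _ => [|p q r s|i _]; rewrite ?subrr ?dvdp0 //.
exact: dvdp_subM.
Qed.

Lemma coef_overp_poly n N : (n <= N)%N -> (overp_poly N)`_n = (overp n)%:R.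
Proof.
move=> le_nN; rewrite overp_partition_sum (partition_prod_coef (fun=> wt)).
have -> : \prod_(i < n) (\sum_(m < n.+1) wt m *: 'X^(i.+1 * m)) =
          \prod_(i < n) (wt_poly n \Po 'X^(i.+1)) :> {poly rat}.
  apply: eq_bigr => i _; rewrite /wt_poly poly_def raddf_sum.
  by apply: eq_bigr => m _; rewrite /= comp_polyZ comp_Xn_poly exprM.
(* The shorter product is padded with factors 1. A factor with n <= i is congruent to 1 modulo
   X^(n+1), since its first nonconstant term has degree i+1 > n. *)
rewrite (big_ord_widen N (fun i => wt_poly n \Po 'X^(i.+1))) // big_mkcond.
apply: (@coef_dvdXn_sub _ _ n.+1) => //; apply: dvdp_sub_prod => i.
apply/dvdXnP => j le_jn; rewrite coefB coef_comp_poly_Xn // coef_poly.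
have le_jiN : (j %/ i.+1 < N.+1)%N.
  by apply: leq_trans (leq_div _ _) _; apply: leq_trans le_nN.
case: (ltnP i n) => [lt_in|le_ni]; last first.
  rewrite coef1 le_jiN; case: j le_jn {le_jiN} => [|j] le_jn.
    by rewrite dvdn0 div0n subrr.
  rewrite /dvdn modn_small ?subrr //.
  by apply: leq_trans le_jn _.
rewrite coef_comp_poly_Xn // coef_poly le_jiN.
by rewrite (leq_trans _ le_jn) ?ltnS ?leq_div // subrr.
Qed.

(** Coefficient of y^i in y W' = W * 2 (y + y^3 + ...), where W = (1 + y) / (1 - y). *)
Lemma wt_convolution i :
  \sum_(j < i.+1) wt j * (2 * (odd (i - j))%:R) = i%:R * wt i.
Proof.
have half m : \sum_(j < m) 2 * (odd j)%:R = m%:R - (odd m)%:R :> rat.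
  elim: m => [|m IHm]; first by rewrite big_ord0 subrr.
  by rewrite big_ord_recr /= IHm -nat1r; case: (odd m) => /=; ring.
(* The term j = 0 alone has weight 1 and gives 2 [i odd]; the others have weight 2 and, after
   reversal, give 2 (i - [i odd]) by [half]. *)
rewrite big_ord_recl /= subn0 mul1r.
under eq_bigr => j _ do rewrite /= /bump /= add1n.
rewrite -mulr_sumr (reindex_inj rev_ord_inj) /=.
under eq_bigr => j _ do rewrite subnSK // subKn ?(ltnW (ltn_ord j)) //.
rewrite half; case: i => [|i]; rewrite /wt /=; first by ring.
ring.
Qed.

Definition twice_odd_poly M : {poly rat} := \poly_(k < M.+1) (2 * (odd k)%:R).

Lemma wt_poly_logderiv M :
  'X^(M.+1) %| 'X * (wt_poly M)^`() - wt_poly M * twice_odd_poly M.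
Proof.
apply/dvdXnP => i lt_iM.
apply/eqP; rewrite coefB subr_eq0 coefXM coefM; apply/eqP.
transitivity (i%:R * wt i).
  case: i lt_iM => [|i] lt_iM /=; first by rewrite mul0r.
  by rewrite coef_deriv coef_poly lt_iM mulr_natl.
rewrite -wt_convolution; apply: eq_bigr => j _; rewrite !coef_poly.
rewrite (leq_ltn_trans (leq_subr _ _) lt_iM).
by rewrite (leq_trans _ lt_iM) // ltnS -ltnS.
Qed.

Lemma dvdXn_comp (p : {poly rat}) d M : (0 < d)%N ->
  'X^M %| p -> 'X^M %| p \Po 'X^d.
Proof.
move=> d_gt0 /dvdpP[r ->]; rewrite comp_polyM comp_Xn_poly -exprM.
by apply/dvdp_mull/dvdp_exp2l; rewrite leq_pmull.
Qed.

(** By the chain rule, ['X] d/d['X] of w(X^d) is d times (y w'(y)) at y = X^d. *)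
Lemma wt_poly_comp_logderiv M d : (0 < d)%N ->
  'X^(M.+1) %| 'X * (wt_poly M \Po 'X^d)^`() -
               (wt_poly M \Po 'X^d) * (d%:R *: (twice_odd_poly M \Po 'X^d)).
Proof.
move=> d_gt0; set q := wt_poly M \Po 'X^d.
have -> : 'X * q^`() - q * (d%:R *: (twice_odd_poly M \Po 'X^d)) =
   d%:R *: (('X * (wt_poly M)^`() - wt_poly M * twice_odd_poly M) \Po 'X^d).
  rewrite /q deriv_comp derivXn comp_polyB !comp_polyM comp_polyX.
  rewrite -mulr_natl -!mul_polyC rmorph_nat.
  by case: d d_gt0 {q} => // d _ /=; rewrite exprS; ring.
rewrite dvdpZr ?Num.Theory.pnatr_eq0 -?lt0n //.
by apply: dvdXn_comp => //; apply: wt_poly_logderiv.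
Qed.

(** Logarithmic derivatives add over products; stating this without quotients lets it hold modulo
    d. *)
Lemma prod_logderiv N (d : {poly rat}) (q s : nat -> {poly rat}) :
  (forall i, (i < N)%N -> d %| 'X * (q i)^`() - q i * s i) ->
  d %| 'X * (\prod_(i < N) q i)^`() - (\prod_(i < N) q i) * \sum_(i < N) s i.
Proof.
elim: N => [|N IHN] dq.
  by rewrite !big_ord0 derivC !mulr0 subrr dvdp0.
rewrite !big_ord_recr /=; set Q := \prod_(i < N) q i; set S := \sum_(i < N) s i.
have -> : 'X * (Q * q N)^`() - Q * q N * (S + s N) =
   ('X * Q^`() - Q * S) * q N + Q * ('X * (q N)^`() - q N * s N).
  by rewrite derivM; ring.
apply: dvdp_add; last exact/dvdp_mull/dq.
by apply/dvdp_mulr/IHN => i lt_iN; apply/dq/ltnW.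
Qed.

(** * Divisor sums and the logarithmic derivative *)

Lemma sigma1_sum m N : (0 < m <= N)%N ->
  sigma1 m = (\sum_(i < N | i.+1 %| m) i.+1)%N.
Proof.
case/andP=> m_gt0 le_mN.
have -> : (\sum_(i < N | i.+1 %| m) i.+1 = \sum_(1 <= d < N.+1 | d %| m) d)%N.
  by rewrite big_add1 big_mkord.
rewrite -big_filter.
apply: perm_big; apply: uniq_perm.
- exact: divisors_uniq.
- exact/filter_uniq/iota_uniq.
move=> d; rewrite mem_filter mem_index_iota -dvdn_divisors //.
case d_m: (d %| m)%N => //=; rewrite (dvdn_gt0 m_gt0) // ltnS.
by rewrite (leq_trans _ le_mN) // dvdn_leq.
Qed.

(** A divisor d of m/2 is a d with 2d dividing m, that is, a divisor of m with even quotient. In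
    [alpha] only the divisors with odd quotient survive. *)
Lemma sigma1bar_sum m N : (0 < m <= N)%N ->
  sigma1bar m = (\sum_(i < N | (i.+1 %| m) && ~~ odd (m %/ i.+1)) i.+1)%N.
Proof.
case/andP=> m_gt0 le_mN; rewrite /sigma1bar.
have dvd2 i : (i.+1 %| m)%N && ~~ odd (m %/ i.+1) = (i.+1 * 2 %| m)%N.
  rewrite -dvdn2; case: (boolP (i.+1 %| m)%N) => [i_m|/negP i_m] /=.
    by rewrite dvdn_divRL // mulnC.
  by apply/esym/negP => /(dvdn_trans (dvdn_mulr 2 (dvdnn _))).
case: ifP => [m2|m2].
  rewrite (@sigma1_sum _ N); last first.
    by rewrite divn_gt0 // dvdn_leq //= (leq_trans (leq_div _ _)).
  by apply: eq_bigl => i; rewrite dvd2 dvdn_divRL.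
rewrite big_pred0 // => i; rewrite dvd2; apply/negP.
by move/(dvdn_trans (dvdn_mull i.+1 (dvdnn 2))); rewrite m2.
Qed.

Lemma alpha_sum m N : (0 < m <= N)%N ->
  alpha m = \sum_(i < N)
    i.+1%:R * (if (i.+1 %| m)%N then 2 * (odd (m %/ i.+1))%:R else 0).
Proof.
move=> mN; rewrite /alpha (sigma1_sum _ _ mN) (sigma1bar_sum _ _ mN).
rewrite !natr_sum !mulr_sumr big_mkcond [X in _ - X]big_mkcond -sumrB.
apply: eq_bigr => i _; case: (i.+1 %| m)%N => /=; last by rewrite mulr0 subrr.
by case: (odd _) => /=; ring.
Qed.

Definition log_overp_poly N := gfpoly (fun i => alpha i.+1 / i.+1%:R) N.

Lemma overp_poly_logderiv N :
  'X^N %| (overp_poly N)^`() - overp_poly N * (log_overp_poly N)^`().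
Proof.
(* Multiplying by ['X] turns the derivative into the degree-preserving operator of [prod_logderiv],
   at the cost of one more power in the modulus. *)
rewrite -(@dvdp_mul2l _ 'X) ?polyX_eq0 // -exprS mulrBr mulrCA.
set q := fun i => wt_poly N \Po 'X^(i.+1).
set s := fun i => i.+1%:R *: (twice_odd_poly N \Po 'X^(i.+1)) : {poly rat}.
have := @prod_logderiv N 'X^(N.+1) q s
  (fun i _ => wt_poly_comp_logderiv N _ (ltn0Sn i)).
rewrite -[\prod_(i < N) q i]/(overp_poly N) => dP.
(* The sum of the [s i] is a Lambert series whose coefficient at X^j, for 0 < j <= N, is [alpha j]
   by [alpha_sum]; that is also the coefficient of [B]. *)
set B := 'X * (log_overp_poly N)^`(); have dB : 'X^(N.+1) %| \sum_(i < N) s i - B.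
  apply/dvdXnP => j lt_jN; apply/eqP; rewrite coefB subr_eq0 coef_sum; apply/eqP.
  have sj i : (s i)`_j =
      i.+1%:R * (if (i.+1 %| j)%N then 2 * (odd (j %/ i.+1))%:R else 0).
    rewrite coefZ coef_comp_poly_Xn // coef_poly.
    by rewrite (leq_ltn_trans (leq_div _ _) lt_jN).
  under eq_bigr => i _ do rewrite sj.
  rewrite coefXM; case: j lt_jN {sj} => [|j] lt_jN.
    by rewrite big1 // => i _; rewrite dvdn0 div0n !mulr0.
  rewrite -alpha_sum //= coef_deriv coef_gfpoly /= -ltnS lt_jN.
  by rewrite -[RHS]mulr_natr divfK ?Num.Theory.pnatr_eq0.
have -> : 'X * (overp_poly N)^`() - overp_poly N * B =
   ('X * (overp_poly N)^`() - overp_poly N * \sum_(i < N) s i) +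
    overp_poly N * (\sum_(i < N) s i - B) by ring.
by apply: dvdp_add => //; apply: dvdp_mull.
Qed.

(** * The exponential and logarithmic formulas *)

Lemma overp0 : overp 0 = 1%N.
Proof.
apply/eqP; rewrite -(Num.Theory.eqr_nat rat) overp_partition_sum.
rewrite (eq_bigl xpredT) => [|b]; last by rewrite /is_partition big_ord0.
under eq_bigr => b _ do rewrite big_ord0.
by rewrite sumr_const card_ffun !card_ord.
Qed.

(** Both polynomials satisfy Y' = Y A' modulo X^n with constant term 1, so [ode_unique] applies. *)
Lemma overp_exp n : (overp n)%:R = (exp_poly (log_overp_poly n) n)`_n.
Proof.
rewrite -(coef_overp_poly n n) //.
apply: (@ode_unique _ _ _ n _ (overp_poly_logderiv n) (deriv_exp_poly _ n)) => //.
rewrite coef_overp_poly // overp0 coef_sum big_ord_recl expr0 coefZ coef1 mulr1.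
rewrite big1 ?addr0 // => k _; rewrite coefZ.
have /dvdXnP-> :=
  dvdXn_gfpoly_exp (fun i => alpha i.+1 / i.+1%:R) n (lift ord0 k).
  by rewrite mulr0.
by rewrite lift0.
Qed.

(** Grouping by length k, the weight (k-1)! meets the 1/k! of [partition_length_coef] and leaves the
    1/k of the logarithm. *)
Lemma partition_log_coef (f : nat -> rat) n : (0 < n)%N ->
  \sum_(b : mults n | is_partition b)
     (-1) ^+ (plength b).-1 * ((plength b).-1)`!%:R *
     \prod_(i < n) (f i ^+ b i / (b i)`!%:R) =
  (log_poly (gfpoly f n) n)`_n.
Proof.
move=> n_gt0; under eq_bigr => b _ do
  under [X in _ * X]eq_bigr => i _ do rewrite mulrC.
rewrite (partition_sum_by_length n (fun k => (-1) ^+ k.-1 * (k.-1)`!%:R)).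
(* Length 0, where the predecessor would be a default value, does not occur since n > 0. *)
rewrite big_ord_recl big_pred0 ?mulr0 ?add0r => [|b]; last first.
  by apply/negP => /andP[/(plength_gt0 _ _ n_gt0)]; rewrite lt0n => /negP/[apply].
rewrite coef_sum; apply: eq_bigr => k _.
have le_kn : (lift ord0 k <= n)%N by rewrite -ltnS.
rewrite partition_length_coef // coefZ.
rewrite lift0 /= factS natrM mulrA; congr (_ * _).
move: ((-1) ^+ k) => e.
by field; rewrite nat1r !Num.Theory.pnatr_eq0 -!lt0n fact_gt0.
Qed.

(** With L = log(1 + G) and P = 1 + G up to degree n, both L' and A' are P'/P modulo X^n; the
    coefficient of X^(n-1) gives the claim. *)
Lemma alpha_log n : (0 < n)%N ->
  alpha n = n%:R * (log_poly (gfpoly (fun i => (overp i.+1)%:R) n) n)`_n.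
Proof.
move=> n_gt0; set G := gfpoly _ n; set L := log_poly G n; set P := overp_poly n.
set A := log_overp_poly n.
have dPG : 'X^(n.+1) %| P - (1 + G).
  apply/dvdXnP => j lt_jn.
  rewrite coefB coefD coef1 coef_gfpoly coef_overp_poly //.
  by case: j lt_jn => [|j] lt_jn /=;
     rewrite ?overp0 ?addr0 -1?ltnS ?lt_jn ?add0r subrr.
have dG' : 'X^n %| P^`() - G^`().
  apply/dvdXnP => j lt_jn; have := coef_dvdXn_sub _ _ n.+1 j.+1 dPG lt_jn.
  by rewrite coefB !coef_deriv coefD coef1 add0r => ->; rewrite subrr.
have dPL : 'X^n %| P * (L^`() - A^`()).
  have -> : P * (L^`() - A^`()) = (P - (1 + G)) * L^`() +
    (((1 + G) * L^`() - G^`()) - (P^`() - G^`())) + (P^`() - P * A^`()) by ring.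
  apply: dvdp_add; last exact: overp_poly_logderiv.
  apply: dvdp_add; first by apply/dvdp_mulr/(dvdp_trans _ dPG)/dvdp_exp2l.
  by apply: dvdp_sub => //; apply: deriv_log_poly.
(* P has constant term 1, so it can be cancelled modulo X^n. *)
have cop : coprimep 'X^n P.
  apply: coprimep_expl; rewrite coprimep_sym coprimepX /root horner_coef0.
  by rewrite coef_overp_poly // overp0 oner_eq0.
have := coef_dvdXn_sub _ _ _ n.-1 (etrans (esym (Gauss_dvdpr _ cop)) dPL).
rewrite !coef_deriv prednK // coef_gfpoly n_gt0 leqnn prednK // => /(_ isT).
rewrite mulr_natl => ->.
by rewrite -[RHS]mulr_natr divfK ?Num.Theory.pnatr_eq0 -?lt0n.
Qed.

Theorem mainTheorem5 (n : nat) (n_gt0 : (0 < n)%N) :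
  [/\ (overp n)%:R =
        (n`!%:R)^-1 * (bell n).@[fun i : 'I_n => i`!%:R * alpha i.+1],
      (overp n)%:R =
        \sum_(b : mults n | is_partition b)
          \prod_(i < n) (((b i)`!%:R)^-1 * (alpha i.+1 / i.+1%:R) ^+ b i)
    & alpha n =
        n%:R * \sum_(b : mults n | is_partition b)
          ((-1) ^+ (plength b).-1 * ((plength b).-1)`!%:R *
           \prod_(i < n) ((overp i.+1)%:R ^+ b i / (b i)`!%:R))].
Proof.
split.
(* Here Y_j = (j-1)! alpha(j), so Y_j / j! = alpha(j) / j is the coefficient of A at X^j. *)
- rewrite (bellE (fun j => (j.-1)`!%:R * alpha j)) overp_exp.
  apply/esym/fps_exp_polyE => j le_jn; rewrite coef_gfpoly le_jn andbT.
  case: j le_jn => [|j] le_jn //=; rewrite factS natrM.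
  by field; rewrite nat1r !Num.Theory.pnatr_eq0 -lt0n fact_gt0.
- by rewrite overp_exp (partition_exp_coef (fun i => alpha i.+1 / i.+1%:R)).
- by rewrite (partition_log_coef (fun i => (overp i.+1)%:R)) // -alpha_log.
Qed.
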